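(* Let $k\geq 2$ be an integer and let $M$ be a minimally $k$-degenerate matroid. Then $|E(M)|\leq (k-1)r(M)+1$. Moreover, equality is attained if and only if $M$ can be obtained via iterated series connections of copies of $U_{1,k}$.
   Context: All matroids are finite, loopless, with non-empty ground set, and may have parallel elements; all restrictions considered are non-empty. The cogirth $g^*(M)$ is the size of a smallest cocircuit of $M$. For an integer $k\geq 2$, a loopless matroid $M$ is minimally $k$-degenerate if $g^*(M)=k$ and every proper (non-empty) restriction of $M$ has cogirth at most $k-1$. $U_{r,n}$ denotes the uniform matroid of rank $r$ on $n$ elements. If $E(M_1)\cap E(M_2)=\{p\}$ and $p$ is neither a loop nor a coloop of $M_1$ or $M_2$, the series connection $S(M_1,M_2)$ with basepoint $p$ is the matroid on $E(M_1)\cup E(M_2)$ whose cocircuits are the cocircuits of $M_1$, the cocircuits of $M_2$, and the sets $(C_1^*\cup C_2^* )-\{p\}$ where $C_i^*$ is a cocircuit of $M_i$ containing $p$ for $i=1,2$. ''Obtained via iterated series connections of copies of $U_{1,k}$'' means belonging to the smallest isomorphism-closed class of matroids that contains $U_{1,k}$ and is closed under series connection ($U_{1,k}$ itself is included). *)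

(* Defs.v *)
From mathcomp Require Import all_boot.

Set Implicit Arguments.
Unset Strict Implicit.
Unset Printing Implicit Defensive.

(* The ground set is a subset of an ambient finite type, so that several
   matroids with overlapping ground sets can live over the same type. *)
Record matroid (T : finType) := Matroid {
  ground : {set T};
  indep : {set {set T}};
  indep_ground : forall I, I \in indep -> I \subset ground;
  indep0 : set0 \in indep;
  indepS : forall I J : {set T}, I \subset J -> J \in indep -> I \in indep;
  indep_aug : forall I J : {set T}, I \in indep -> J \in indep -> #|I| < #|J| ->
    exists2 x, x \in J :\: I & x |: I \in indep
}.

Section MatroidTheory.
Variables (T : finType) (M : matroid T).
Implicit Types (X B C I J : {set T}).

Definition base B : bool := maxset (fun I => I \in indep M) B.

Definition circuit C : bool :=
  minset (fun X => (X \subset ground M) && (X \notin indep M)) C.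

Definition is_loop (e : T) : bool :=
  (e \in ground M) && ([set e] \notin indep M).

Definition loopless : bool := [forall e, ~~ is_loop e].

Definition rank : nat := \max_(I in indep M) #|I|.

Lemma base_indep B : base B -> B \in indep M.
Proof. by case/maxsetP. Qed.

Lemma base_exists I : I \in indep M -> exists2 B, base B & I \subset B.
Proof.
by move=> hI; have [B hB sIB] := @maxset_exists _ (fun I => I \in indep M) I hI;
  exists B.
Qed.

Lemma indep_extend I J : I \in indep M -> J \in indep M -> #|I| <= #|J| ->
  exists K, [/\ K \in indep M, I \subset K, K \subset I :|: J & #|K| = #|J|].
Proof.
move=> hI hJ; move dn: (#|J| - #|I|) => n.
elim: n I hI dn => [|n IHn] I hI dn leIJ.
  exists I; split=> //; first exact: subsetUl.
  by apply/eqP; rewrite eqn_leq leIJ -subn_eq0 dn.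
have ltIJ : #|I| < #|J| by rewrite -subn_gt0 dn.
have [x] := indep_aug hI hJ ltIJ; rewrite inE => /andP[xI xJ] hxI.
have cxI : #|x |: I| = #|I|.+1 by rewrite cardsU1 xI.
case: (IHn (x |: I)) => //; rewrite ?cxI ?subnS ?dn //.
move=> K [hK sK sKJ cK]; exists K; split=> //.
  by apply: subset_trans sK; apply: subsetUr.
apply: (subset_trans sKJ); rewrite !subUset subsetUl subsetUr sub1set inE xJ.
by rewrite orbT.
Qed.

Lemma indep_le_base I B : I \in indep M -> base B -> #|I| <= #|B|.
Proof.
move=> hI /maxsetP[hB maxB]; rewrite leqNgt; apply/negP => ltBI.
have [x] := indep_aug hB hI ltBI; rewrite inE => /andP[xB _] hxB.
by move/negP: xB; apply; rewrite -(maxB _ hxB (subsetUr _ _)) setU11.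
Qed.

Lemma base_card I B : I \in indep M -> base B -> #|I| = #|B| -> base I.
Proof.
move=> hI hB cI; have [B' hB' sIB'] := base_exists hI.
suff -> : I = B' by [].
by apply/eqP; rewrite eqEcard sIB' cI indep_le_base // base_indep.
Qed.

Definition restrict_indep X : {set {set T}} := [set I in indep M | I \subset X].

Lemma restrict_ground X I :
  I \in restrict_indep X -> I \subset ground M :&: X.
Proof. by rewrite inE subsetI => /andP[/indep_ground-> ->]. Qed.

Lemma restrict_indep0 X : set0 \in restrict_indep X.
Proof. by rewrite inE indep0 sub0set. Qed.

Lemma restrict_indepS X I J :
  I \subset J -> J \in restrict_indep X -> I \in restrict_indep X.
Proof.
move=> sIJ; rewrite !inE => /andP[hJ sJX].
by rewrite (indepS sIJ hJ) (subset_trans sIJ sJX).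
Qed.

Lemma restrict_indep_aug X I J :
  I \in restrict_indep X -> J \in restrict_indep X -> #|I| < #|J| ->
  exists2 x, x \in J :\: I & x |: I \in restrict_indep X.
Proof.
rewrite !inE => /andP[hI sIX] /andP[hJ sJX] ltIJ.
have [x xJI hxI] := indep_aug hI hJ ltIJ; exists x => //.
rewrite inE hxI subUset sub1set sIX andbT.
by move: xJI; rewrite inE => /andP[_ /(subsetP sJX)].
Qed.

Definition restrict X : matroid T :=
  Matroid (@restrict_ground X) (restrict_indep0 X) (@restrict_indepS X)
    (@restrict_indep_aug X).

Definition coindep : {set {set T}} :=
  [set X : {set T} |
    (X \subset ground M) && [exists B, base B && [disjoint X & B]]].

Lemma coindepP X :
  reflect (X \subset ground M /\ exists2 B, base B & [disjoint X & B])
          (X \in coindep).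
Proof.
rewrite inE; apply: (iffP andP) => -[sX h]; split=> //.
  by case/existsP: h => B /andP[]; exists B.
by case: h => B hB dB; apply/existsP; exists B; rewrite hB.
Qed.

Lemma coindep_ground X : X \in coindep -> X \subset ground M.
Proof. by case/coindepP. Qed.

Lemma coindep0 : set0 \in coindep.
Proof.
have [B hB _] := base_exists (indep0 M).
apply/coindepP; split; [exact: sub0set | exists B => //].
by rewrite -setI_eq0 set0I.
Qed.

Lemma coindepS I J : I \subset J -> J \in coindep -> I \in coindep.
Proof.
move=> sIJ /coindepP[sJ [B hB dB]]; apply/coindepP; split.
  exact: subset_trans sJ.
by exists B => //; apply: disjointWl dB.
Qed.

Lemma coindep_aug I J : I \in coindep -> J \in coindep -> #|I| < #|J| ->
  exists2 x, x \in J :\: I & x |: I \in coindep.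
Proof.
move=> /coindepP[sI [B1 hB1 dB1]] /coindepP[sJ [B2 hB2 dB2]] ltIJ.
have hB2I : B2 :\: I \in indep M by apply: indepS (base_indep hB2); exact: subsetDl.
have [K [hK sK sKU cK]] :=
  indep_extend hB2I (base_indep hB1) (indep_le_base hB2I hB1).
have bK : base K := base_card hK hB1 cK.
have dIK : [disjoint I & K].
  rewrite disjoint_subset; apply/subsetP => x xI; rewrite !inE; apply/negP.
  by move/(subsetP sKU); rewrite !inE xI /= (disjointFr dB1 xI).
have [sJK|] := boolP (J :\: I \subset K); last first.
  case/subsetPn => x xJI xK; exists x => //; apply/coindepP; split.
    rewrite subUset sI sub1set andbT.
    by move: xJI; rewrite inE => /andP[_ /(subsetP sJ)].
  exists K => //; rewrite -setI_eq0 setIUl (disjoint_setI0 dIK) setU0.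
  by rewrite setI_eq0 disjoints1.
have dJB : [disjoint J :\: I & B2 :\: I].
  by apply: disjointW dB2; apply: subsetDl.
have leU : #|J :\: I| + #|B2 :\: I| <= #|K|.
  move: (leq_card_setU (J :\: I) (B2 :\: I)) => /leqifP; rewrite dJB => /eqP <-.
  by apply: subset_leq_card; rewrite subUset sJK.
have leB : #|B2 :&: I| <= #|I :\: J|.
  apply: subset_leq_card; apply/subsetP => x; rewrite !inE => /andP[xB ->].
  by rewrite andbT; apply/negP => xJ; move: (disjointFr dB2 xJ); rewrite xB.
have ltD : #|I :\: J| < #|J :\: I|.
  by rewrite -(ltn_add2l #|I :&: J|) cardsID setIC cardsID.
have := indep_le_base hK hB2; rewrite leqNgt => /negP[].
rewrite -(cardsID I B2); apply: leq_trans leU.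
by rewrite ltn_add2r; apply: leq_ltn_trans ltD.
Qed.

Definition dual : matroid T :=
  Matroid coindep_ground coindep0 coindepS coindep_aug.

End MatroidTheory.

Definition is_coloop (T : finType) (M : matroid T) (e : T) : bool :=
  is_loop (dual M) e.

Definition cocircuit (T : finType) (M : matroid T) (C : {set T}) : bool :=
  circuit (dual M) C.

(* The neutral value #|ground M|.+1 exceeds the size of every cocircuit, so it
   is returned only when there is no cocircuit, i.e. when M has rank 0; this
   never happens for a loopless matroid with a non-empty ground set. *)
Definition cogirth (T : finType) (M : matroid T) : nat :=
  \big[minn/#|ground M|.+1]_(C : {set T} | cocircuit M C) #|C|.

Definition minimally_degenerate (T : finType) (k : nat) (M : matroid T) : Prop :=
  [/\ loopless M,
      ground M != set0,
      cogirth M = k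
    & forall X : {set T}, X != set0 -> X \proper ground M ->
        cogirth (restrict M X) <= k - 1].

Section Uniform.
Variables r n : nat.

Definition uniform_indep : {set {set 'I_n}} := [set I : {set 'I_n} | #|I| <= r].

Lemma uniform_ground I : I \in uniform_indep -> I \subset [set: 'I_n].
Proof. by move=> _; exact: subsetT. Qed.

Lemma uniform_indep0 : set0 \in uniform_indep.
Proof. by rewrite inE cards0. Qed.

Lemma uniform_indepS (I J : {set 'I_n}) :
  I \subset J -> J \in uniform_indep -> I \in uniform_indep.
Proof. by move=> sIJ; rewrite !inE; apply: leq_trans; apply: subset_leq_card. Qed.

Lemma uniform_indep_aug (I J : {set 'I_n}) :
  I \in uniform_indep -> J \in uniform_indep -> #|I| < #|J| ->
  exists2 x, x \in J :\: I & x |: I \in uniform_indep.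
Proof.
rewrite !inE => hI hJ ltIJ.
have /subsetPn[x xJ xI] : ~~ (J \subset I).
  by apply: contraL ltIJ => /subset_leq_card; rewrite -leqNgt.
by exists x; rewrite inE ?xI // cardsU1 xI (leq_trans ltIJ).
Qed.

Definition uniform : matroid 'I_n :=
  Matroid uniform_ground uniform_indep0 uniform_indepS uniform_indep_aug.

End Uniform.

Definition isomorphic (T1 T2 : finType) (M1 : matroid T1) (M2 : matroid T2) :
    Prop :=
  exists f : T1 -> T2,
    [/\ {in ground M1 &, injective f},
        f @: ground M1 = ground M2
      & forall I : {set T1}, I \subset ground M1 ->
          (I \in indep M1) = (f @: I \in indep M2)].

(* [series_connection p M1 M2 M] means that M is S(M1, M2) with basepoint p;
   M is determined by its ground set and its cocircuits. *)
Definition series_connection (T : finType) (p : T) (M1 M2 M : matroid T) : Prop :=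
  [/\ ground M1 :&: ground M2 = [set p],
      [&& ~~ is_loop M1 p, ~~ is_coloop M1 p, ~~ is_loop M2 p & ~~ is_coloop M2 p],
      ground M = ground M1 :|: ground M2
    & forall C : {set T}, cocircuit M C <->
        [\/ cocircuit M1 C,
            cocircuit M2 C
          | exists C1 C2 : {set T},
              [/\ cocircuit M1 C1 /\ p \in C1,
                  cocircuit M2 C2 /\ p \in C2
                & C = (C1 :|: C2) :\ p]]].

Inductive iterated_series (k : nat) : forall T : finType, matroid T -> Prop :=
| iterated_series_uniform : iterated_series k (uniform 1 k)
| iterated_series_iso (T1 T2 : finType) (M1 : matroid T1) (M2 : matroid T2) :
    iterated_series k M1 -> isomorphic M1 M2 -> iterated_series k M2
| iterated_series_connection (T : finType) (p : T) (M1 M2 M : matroid T) :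
    iterated_series k M1 -> iterated_series k M2 ->
    series_connection p M1 M2 M -> iterated_series k M.

(* Main.v *)
Require Import Defs.
From mathcomp Require Import all_boot zify.

(**
  Every proper set X satisfies |X| <= (k-1) r(X), by repeatedly removing small
  cocircuits of restrictions, and deleting one element and then a small cocircuit
  gives the bound for M.  If equality holds for M and r(M) > 1, then peeling a tight
  hyperplane down to rank 1 gives a set P of k-1 parallel elements; a tight
  hyperplane H avoiding an element of P avoids all of P, so E = H + P + e.  Then M is
  the series connection, with basepoint e, of M/H = U_{1,k} and M/P, and M/P is again
  minimally k-degenerate with equality, so that induction on the rank applies.

  Conversely, the union of two cobases containing the basepoint is a cobase of the
  series connection, so ranks add.
*)

Set Implicit Arguments.
Unset Strict Implicit.
Unset Printing Implicit Defensive.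

(** * The rank function, and cocircuits in terms of it *)

Definition rk (T : finType) (M : matroid T) (X : {set T}) : nat :=
  rank (restrict M X).

Section RankFunction.
Variables (T : finType) (M : matroid T).
Implicit Types (I J K B C X Y : {set T}) (x y : T).
Local Notation E := (ground M).

Lemma leq_card_rk I X : I \in indep M -> I \subset X -> #|I| <= rk M X.
Proof.
by move=> hI sIX; rewrite /rk /rank (bigmax_sup I) // inE hI.
Qed.

Lemma rk_basis X :
  exists I, [/\ I \in indep M, I \subset X, I \subset E & #|I| = rk M X].
Proof.
have h0 : 0 < #|[pred I | I \in indep (restrict M X)]|.
  by apply/card_gt0P; exists set0; apply: (indep0 (restrict M X)).
have [I hI eI] := eq_bigmax_cond (fun I : {set T} => #|I|) h0.
have /andP[hI' sIX] : (I \in indep M) && (I \subset X) by move: hI; rewrite !inE.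
by exists I; split=> //; apply: indep_ground.
Qed.

Lemma rk_leq X n :
  (forall I, I \in indep M -> I \subset X -> #|I| <= n) -> rk M X <= n.
Proof. by have [I [hI sI _ <-]] := rk_basis X; apply. Qed.

Lemma rkS X Y : X \subset Y -> rk M X <= rk M Y.
Proof.
move=> sXY; apply: rk_leq => I hI sI.
by apply: leq_card_rk => //; apply: subset_trans sXY.
Qed.

Lemma rk_card X : rk M X <= #|X|.
Proof. by apply: rk_leq => I _; apply: subset_leq_card. Qed.

Lemma rk0 : rk M set0 = 0.
Proof. by apply/eqP; rewrite -leqn0 (leq_trans (rk_card _)) ?cards0. Qed.

Lemma rank_rk : rank M = rk M E.
Proof.
apply/eqP; rewrite eqn_leq; apply/andP; split.
  by apply/bigmax_leqP => I hI; apply: leq_card_rk => //; apply: indep_ground.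
by apply: rk_leq => I hI _; rewrite /rank (bigmax_sup I).
Qed.

Lemma indep_extend_rk I X : I \in indep M -> I \subset X ->
  exists K, [/\ K \in indep M, I \subset K, K \subset X & #|K| = rk M X].
Proof.
move=> hI sI; have [J [hJ sJ _ eJ]] := rk_basis X.
have [] := indep_extend hI hJ; first by rewrite eJ leq_card_rk.
move=> K [hK sK sKU cK]; exists K; split=> //; last by rewrite cK.
by apply: subset_trans sKU _; rewrite subUset sI.
Qed.

(** Submodularity: a basis [I] of [X :&: Y] grows to a basis [L] of [X :|: Y]. The sets [L :&: X]
    and [L :&: Y] are independent, cover [L], and both contain [I]. *)
Lemma rkUI X Y : rk M (X :|: Y) + rk M (X :&: Y) <= rk M X + rk M Y.
Proof.
have [I [hI sI _ eI]] := rk_basis (X :&: Y).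
have [|L [hL sL sLU eL]] := @indep_extend_rk I (X :|: Y) hI.
  by apply: subset_trans sI _; rewrite subIset // subsetUl.
have hX : #|L :&: X| <= rk M X.
  by apply: leq_card_rk; rewrite ?subsetIr //; apply: indepS hL; apply: subsetIl.
have hY : #|L :&: Y| <= rk M Y.
  by apply: leq_card_rk; rewrite ?subsetIr //; apply: indepS hL; apply: subsetIl.
have hXY : rk M (X :&: Y) <= #|L :&: X :&: (L :&: Y)|.
  rewrite -eI subset_leq_card //; move: sI sL; rewrite !subsetI.
  by move=> /andP[-> ->] ->.
have := cardsUI (L :&: X) (L :&: Y); rewrite -setIUr (setIidPl sLU) eL; lia.
Qed.

Lemma rkU X Y : rk M (X :|: Y) <= rk M X + rk M Y.
Proof. by have := rkUI X Y; lia. Qed.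

Lemma rkU1 x X : rk M (x |: X) <= (rk M X).+1.
Proof.
by have := rkU [set x] X; have := rk_card [set x]; rewrite cards1; lia.
Qed.

(** Monotonicity of closure: if [X] spans [Z], so does any larger [Y], by submodularity for [Y] and
    [X :|: Z]. *)
Lemma rkU_closure X Y Z :
  X \subset Y -> rk M (X :|: Z) = rk M X -> rk M (Y :|: Z) = rk M Y.
Proof.
move=> sXY eX; apply/eqP; rewrite eqn_leq (rkS (subsetUl _ _)) andbT.
have := rkUI Y (X :|: Z); rewrite setUA (setUidPl sXY).
have : rk M X <= rk M (Y :&: (X :|: Z)) by apply: rkS; rewrite subsetI sXY subsetUl.
lia.
Qed.

Lemma base_rk B : base M B -> #|B| = rank M.
Proof.
move=> hB; rewrite rank_rk; apply/eqP; rewrite eqn_leq.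
rewrite (leq_card_rk (base_indep hB) (indep_ground (base_indep hB))) /=.
by apply: rk_leq => I hI _; apply: (indep_le_base hI hB).
Qed.

Lemma coindep_rk X : (X \in indep (dual M)) = (X \subset E) && (rank M <= rk M (E :\: X)).
Proof.
apply/coindepP/andP => -[sX].
  case=> B hB dB; split=> //; rewrite -(base_rk hB); apply: leq_card_rk.
    exact: base_indep.
  by rewrite subsetD indep_ground ?base_indep //= disjoint_sym.
move=> leX; split=> //; have [I [hI sI _ eI]] := rk_basis (E :\: X).
exists I; last by move: sI; rewrite subsetD disjoint_sym => /andP[].
have [B hB sIB] := base_exists hI; suff -> : I = B by [].
by apply/eqP; rewrite eqEcard sIB eI (base_rk hB).
Qed.

(** Cocircuits are the complements of hyperplanes: coindependence means that the complement spans,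
    and minimality means that returning any one element restores full rank. *)
Lemma cocircuitP C :
  reflect [/\ C \subset E, rk M (E :\: C) < rank M
            & {in C, forall x, rank M <= rk M (x |: (E :\: C))}]
          (cocircuit M C).
Proof.
apply: (iffP minsetP) => -[].
  case/andP=> sC; rewrite coindep_rk sC -ltnNge /= => ltC minC.
  split=> // x xC; rewrite leqNgt; apply/negP => ltx.
  have sD : C :\ x \subset E by apply: subset_trans sC; apply: subsetDl.
  have eD : C :\ x = C.
    apply: minC; last exact: subsetDl.
    rewrite [_ \subset _]sD coindep_rk sD -ltnNge /=.
    rewrite setDDr [E :&: _](setIidPr _) ?sub1set ?(subsetP sC) //.
    by rewrite setUC.
  by have := setD11 x C; rewrite eD xC.
move=> sC ltC minC; split; first by rewrite [_ \subset _]sC coindep_rk sC -ltnNge.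
move=> D /andP[sD]; rewrite coindep_rk sD -ltnNge /= => ltD sDC.
apply/eqP; rewrite eqEsubset sDC /=; apply/subsetP => x xC.
apply/negPn/negP => xD; move: ltD; rewrite ltnNge => /negP; apply.
apply: leq_trans (minC _ xC) (rkS _); rewrite subUset sub1set inE xD setDS //.
by rewrite (subsetP sC).
Qed.

Lemma rk_restrict X Y : rk (restrict M X) Y = rk M (X :&: Y).
Proof.
rewrite /rk /rank; apply: eq_bigl => I.
by rewrite !inE subsetI andbA.
Qed.

End RankFunction.

(** * Cobases, and the size and rank of series connections *)

(** A cobase misses some base [B]; since [ground M :\: B] is itself coindependent, maximality makes
    the two equal. *)
Lemma base_dual_card (T : finType) (M : matroid T) (K : {set T}) :
  base (dual M) K -> #|K| + rank M = #|ground M|.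
Proof.
move=> hK; have /coindepP[sK [B hB dKB]] := base_indep hK.
suff eK : K = ground M :\: B.
  have sB := indep_ground (base_indep hB).
  by rewrite -(base_rk hB) eK cardsDS // subnK // subset_leq_card.
apply/esym; case/maxsetP: hK => _; apply.
  apply/coindepP; split; first exact: subsetDl.
  by exists B; rewrite // disjoint_sym disjoints_subset; apply/subsetP => x xB; rewrite !inE xB.
by rewrite subsetD sK.
Qed.

Lemma exists_base_dual (T : finType) (M : matroid T) (p : T) :
  p \in ground M -> ~~ is_coloop M p -> exists2 K, base (dual M) K & p \in K.
Proof.
move=> pE; rewrite /is_coloop /is_loop [p \in _]pE /= negbK => hp.
by have [K hK] := @base_exists _ (dual M) _ hp; rewrite sub1set; exists K.
Qed.

Lemma dual_dep_cocircuit (T : finType) (M : matroid T) (X : {set T}) :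
  X \subset ground M -> X \notin indep (dual M) -> exists2 C, cocircuit M C & C \subset X.
Proof.
move=> sX hX.
have [|C hC sC] := @minset_exists _ 
    (fun X => (X \subset ground (dual M)) && (X \notin indep (dual M))) X.
  by rewrite [_ \subset _]sX.
by exists C.
Qed.

Lemma exists_cocircuit (T : finType) (M : matroid T) (X : {set T}) :
  X \subset ground M -> rk M X < rank M ->
  exists2 C, cocircuit M C & C \subset ground M :\: X.
Proof.
move=> sX ltX; apply: dual_dep_cocircuit; first exact: subsetDl.
by rewrite coindep_rk subsetDl -ltnNge setDDr setDv set0U (setIidPr sX).
Qed.

Lemma cocircuit_dep (T : finType) (M : matroid T) (C X : {set T}) :
  cocircuit M C -> C \subset X -> X \notin indep (dual M).
Proof.
case/minsetP => /andP[_ hC] _ sCX; apply: contra hC => hX.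
exact: indepS hX.
Qed.

(** The rank is the size of the ground set minus that of a cobase. Both the two ground sets and the
    two cobases [K1], [K2] overlap in exactly [p], so the corrections cancel. *)
Lemma series_connection_rank (T : finType) (p : T) (M1 M2 M : matroid T) :
  series_connection p M1 M2 M -> rank M = rank M1 + rank M2.
Proof.
case=> e12 /and4P[_ c1 _ c2] eE hC.
have pE i : p \in ground (if i then M1 else M2).
  by have := set11 p; rewrite -e12 inE; case: i => /andP[].
have [K1 hK1 pK1] := exists_base_dual (pE true) c1.
have [K2 hK2 pK2] := exists_base_dual (pE false) c2.
have sK1 : K1 \subset ground M1 := indep_ground (base_indep hK1).
have sK2 : K2 \subset ground M2 := indep_ground (base_indep hK2).
(* Elements of [K2] lying in [ground M1] can only be [p], which belongs to [K1]. *)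
have sub1 (C : {set T}) : C \subset ground M1 -> C \subset K1 :|: K2 -> C \subset K1.
  move=> sC sCK; apply/subsetP => x xC.
  have /setUP[//|xK2] := subsetP sCK x xC.
  have : x \in [set p] by rewrite -e12 inE (subsetP sC) // (subsetP sK2).
  by move/set1P->.
have sub2 (C : {set T}) : C \subset ground M2 -> C \subset K1 :|: K2 -> C \subset K2.
  move=> sC sCK; apply/subsetP => x xC.
  have /setUP[xK1|//] := subsetP sCK x xC.
  have : x \in [set p] by rewrite -e12 inE (subsetP sC) // (subsetP sK1).
  by move/set1P->.
have cs (N : matroid T) C : cocircuit N C -> C \subset ground N by case/cocircuitP.
have nd (N : matroid T) C K : base (dual N) K -> cocircuit N C -> C \subset K -> False.
  by move=> hK hCN /(cocircuit_dep hCN); rewrite base_indep.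
have hK : base (dual M) (K1 :|: K2).
  apply/maxsetP; split.
    apply: contraT => /dual_dep_cocircuit[|C].
      by rewrite eE setUSS.
    move=> hCM sCK; case/hC: hCM => [h1|h2|[C1 [C2 [[h1 p1] [h2 p2] eC]]]].
    - by case: (nd _ _ _ hK1 h1 (sub1 _ (cs _ _ h1) sCK)).
    - by case: (nd _ _ _ hK2 h2 (sub2 _ (cs _ _ h2) sCK)).
    (* Only [p] is lost from [C1] in the joined cocircuit, and [p] is in [K1], so all of [C1] would
       lie in [K1]. *)
    case: (nd _ _ _ hK1 h1); apply: sub1 (cs _ _ h1) _.
    apply/subsetP => x xC1; have [->|xp] := eqVneq x p; first by rewrite inE pK1.
    by apply: (subsetP sCK); rewrite eC !inE xp xC1.
  move=> L hL sKL; apply/eqP; rewrite eqEsubset sKL andbT.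
  apply/subsetP => x xL; apply: contraT; rewrite inE negb_or => /andP[xK1 xK2].
  have sL : L \subset ground M1 :|: ground M2 by rewrite -eE; apply: indep_ground hL.
  (* Maximality: adding [x] to the cobase of the side containing it creates a cocircuit of that side
     inside [L], which is also a cocircuit of [M]. *)
  have ext (N : matroid T) K : base (dual N) K -> x \notin K -> x \in ground N -> K \subset L ->
      exists2 C, cocircuit N C & C \subset L.
    move=> hKN xK xN sKL'; have [||C hCN sC] := @dual_dep_cocircuit _ N (x |: K).
    - by rewrite subUset sub1set xN; apply: (indep_ground (base_indep hKN)).
    - apply/negP => hx; case/maxsetP: hKN => _ /(_ _ hx (subsetUr _ _)) eK.
      by case/negP: xK; rewrite -eK setU11.
    by exists C => //; apply: subset_trans sC _; rewrite subUset sub1set xL.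
  have [C hCM sC] : exists2 C, cocircuit M C & C \subset L.
    case/setUP: (subsetP sL _ xL) => xE.
      have [C h1 sC] := ext _ _ hK1 xK1 xE (subset_trans (subsetUl _ _) sKL).
      by exists C => //; apply/hC; apply: Or31.
    have [C h1 sC] := ext _ _ hK2 xK2 xE (subset_trans (subsetUr _ _) sKL).
    by exists C => //; apply/hC; apply: Or32.
  by have := cocircuit_dep hCM sC; rewrite hL.
have eK12 : K1 :&: K2 = [set p].
  apply/eqP; rewrite eqEsubset sub1set inE pK1 pK2 -e12 setISS //.
have := base_dual_card hK; have := base_dual_card hK1; have := base_dual_card hK2.
have := cardsUI K1 K2; have := cardsUI (ground M1) (ground M2).
rewrite eE eK12 e12 cards1; lia.
Qed.

Lemma isomorphic_rank (T1 T2 : finType) (M1 : matroid T1) (M2 : matroid T2) :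
  isomorphic M1 M2 -> #|ground M2| = #|ground M1| /\ rank M2 = rank M1.
Proof.
case=> f [fI fE hf]; split; first by rewrite -fE card_in_imset.
have cI (I : {set T1}) : I \subset ground M1 -> #|f @: I| = #|I|.
  by move=> sI; apply: card_in_imset => x y xI yI; apply: fI; apply: (subsetP sI).
rewrite !rank_rk; apply/eqP; rewrite eqn_leq; apply/andP; split.
  apply: rk_leq => J hJ sJ.
  pose I := [set x in ground M1 | f x \in J].
  have sI : I \subset ground M1 by apply/subsetP => x; rewrite inE => /andP[].
  have eJ : f @: I = J.
    apply/setP => y; apply/imsetP/idP => [[x]|yJ].
      by rewrite inE => /andP[_ ? ->].
    have : y \in f @: ground M1 by rewrite fE (subsetP sJ).
    by case/imsetP => x xE ey; exists x => //; rewrite inE xE -ey.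
  rewrite -eJ cI //; apply: leq_card_rk => //; by rewrite hf // eJ.
apply: rk_leq => I hI sI; rewrite -cI //; apply: leq_card_rk; first by rewrite -hf.
by rewrite -fE imsetS.
Qed.

(** Since the basepoint is shared, the size of the ground set minus 1 is additive under series
    connection, just as the rank is. *)
Lemma iterated_series_card (T : finType) (k : nat) (M : matroid T) :
  0 < k -> iterated_series k M -> #|ground M| = (k - 1) * rank M + 1.
Proof.
move=> hk; elim=> {T M} [|T1 T2 M1 M2 _ IH /isomorphic_rank[-> ->] //|T p M1 M2 M _ IH1 _ IH2 hS].
  rewrite cardsT card_ord (_ : rank _ = 1); first by lia.
  apply/eqP; rewrite eqn_leq; apply/andP; split.
    by apply/bigmax_leqP => I; rewrite inE.
  by rewrite /rank (bigmax_sup [set Ordinal hk]) ?inE ?cards1.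
rewrite (series_connection_rank hS); case: hS => e12 _ -> _.
have := cardsUI (ground M1) (ground M2).
rewrite e12 cards1 IH1 IH2 mulnDr; lia.
Qed.

Lemma indep1_rk (T : finType) (M : matroid T) (x : T) :
  ([set x] \in indep M) = (0 < rk M [set x]).
Proof.
apply/idP/idP => [hx|]; first by rewrite -(cards1 x); apply: leq_card_rk.
have [I [hI sI _ <-]] := rk_basis M [set x].
by move: sI; rewrite subset1 => /orP[] /eqP eI; rewrite -?eI // eI cards0.
Qed.

(** * Contraction *)

Section Contraction.
Variables (T : finType) (M : matroid T) (A B : {set T}).
Hypothesis indB : B \in indep M.

(** When [B] is a basis of [A], these are the independent sets of the contraction M/A. *)
Definition contract_indep : {set {set T}} :=
  [set I : {set T} | (I \subset ground M :\: A) && (I :|: B \in indep M)].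

Lemma contract_ground I : I \in contract_indep -> I \subset ground M :\: A.
Proof. by rewrite inE => /andP[]. Qed.

Lemma contract_indep0 : set0 \in contract_indep.
Proof. by rewrite inE sub0set set0U. Qed.

Lemma contract_indepS (I J : {set T}) :
  I \subset J -> J \in contract_indep -> I \in contract_indep.
Proof.
move=> sIJ; rewrite !inE => /andP[sJ hJ]; rewrite (subset_trans sIJ sJ) /=.
by apply: indepS hJ; apply: setSU.
Qed.

Hypothesis sBA : B \subset A.

Lemma contract_indep_aug (I J : {set T}) :
  I \in contract_indep -> J \in contract_indep -> #|I| < #|J| ->
  exists2 x, x \in J :\: I & x |: I \in contract_indep.
Proof.
rewrite !inE => /andP[sI hI] /andP[sJ hJ] ltIJ.
have cB (K : {set T}) : K \subset ground M :\: A -> #|K :|: B| = #|K| + #|B|.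
  rewrite subsetD => /andP[_ dKA]; have := cardsUI K B.
  by rewrite (disjoint_setI0 (disjointWr sBA dKA)) cards0 addn0.
have [|x] := indep_aug hI hJ; first by rewrite !cB // ltn_add2r.
rewrite !inE negb_or => /andP[/andP[xI xB]]; rewrite (negPf xB) orbF => xJ hx.
exists x; first by rewrite inE xI.
by rewrite inE -setUA hx subUset sub1set (subsetP sJ) // sI.
Qed.

Definition contract : matroid T :=
  Matroid contract_ground contract_indep0 contract_indepS contract_indep_aug.

End Contraction.

(** The rank formula of M/A, in additive form to avoid truncated subtraction. It is a relation, so
    that later arguments do not depend on a chosen basis of [A]. *)
Definition is_contraction (T : finType) (M : matroid T) (A : {set T}) (N : matroid T) :=
  ground N = ground M :\: A /\
  forall X : {set T}, X \subset ground N -> rk N X + rk M A = rk M (X :|: A).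

(** For the lower bound on the rank in the contraction, extend the basis [B] of [A] to a basis [L]
    of [X :|: A]; then [L] meets [A] only in [B], and [L :\: A] is independent in the
    contraction. *)
Lemma exists_contraction (T : finType) (M : matroid T) (A : {set T}) :
  exists N, is_contraction M A N.
Proof.
have [B [hB sB _ cB]] := rk_basis M A.
exists (contract hB sB); split=> // X sX.
apply/eqP; rewrite eqn_leq; apply/andP; split.
  have [I [hI sI _ <-]] := rk_basis (contract hB sB) X.
  move: hI; rewrite inE => /andP[]; rewrite subsetD => /andP[_ dIA] hIB.
  have := cardsUI I B; rewrite (disjoint_setI0 (disjointWr sB dIA)) cards0 addn0 cB.
  by move=> <-; apply: leq_card_rk => //; apply: setUSS.
have [L [hL sBL sL <-]] := indep_extend_rk hB (subset_trans sB (subsetUr X A)).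
have eLA : L :&: A = B.
  apply/esym/eqP; rewrite eqEcard subsetI sBL sB cB.
  by apply: leq_card_rk; [apply: indepS hL; apply: subsetIl | apply: subsetIr].
rewrite -(cardsID A L) eLA cB addnC leq_add2r; apply: leq_card_rk.
  rewrite inE setSD ?indep_ground //=; suff -> : L :\: A :|: B = L by [].
  by rewrite -eLA setUC setID.
by rewrite subDset setUC.
Qed.

Section ContractionTheory.
Variables (T : finType) (M N : matroid T) (A : {set T}).
Hypotheses (sA : A \subset ground M) (hN : is_contraction M A N).

Lemma contraction_rank : rank N + rk M A = rank M.
Proof.
by rewrite !rank_rk hN.2 // hN.1 -{2}(setIidPr sA) setUC setID.
Qed.

(** For [C] avoiding [A], the complement of [C] in [N] together with [A] is its complement in [M],
    so all ranks in [cocircuitP] shift by [rk M A]. *)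
Lemma contraction_cocircuit (C : {set T}) :
  cocircuit N C <-> cocircuit M C /\ C \subset ground M :\: A.
Proof.
have [eN rN] := hN; have rE := contraction_rank.
have eU : C \subset ground M :\: A -> ground N :\: C :|: A = ground M :\: C.
  rewrite eN subsetD => /andP[sC dC]; apply/setP => x; rewrite !inE.
  case: (boolP (x \in A)) => [xA|_]; last by rewrite orbF.
  by rewrite orbT (disjointFl dC xA) (subsetP sA).
split.
  case/cocircuitP => sC ltC minC; rewrite -eN; split=> //.
  apply/cocircuitP; split.
  - by apply: subset_trans sC _; rewrite eN subsetDl.
  - by rewrite -eU -?eN // -rN ?subsetDl // -rE ltn_add2r.
  move=> x xC; rewrite -eU -?eN // setUA -rN -?rE ?leq_add2r ?minC //.
  by rewrite subUset sub1set (subsetP sC) // subsetDl.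
case=> /cocircuitP[sC ltC minC] sCA; apply/cocircuitP; rewrite -eN in sCA.
have eU' := eU; rewrite -eN in eU'.
split=> //; first by rewrite -(ltn_add2r (rk M A)) rN ?subsetDl // rE eU'.
move=> x xC; rewrite -(leq_add2r (rk M A)) rN ?rE -?setUA ?eU' ?minC //.
by rewrite subUset sub1set (subsetP sCA) // subsetDl.
Qed.

End ContractionTheory.

(** * Recognising a series connection from a separation after deleting an element *)

(* Deleting [e] disconnects [M] into the parts [A] and [B]. *)
Definition separates (T : finType) (M : matroid T) (e : T) (A B : {set T}) : Prop :=
  [/\ ground M = e |: (A :|: B), e \notin A :|: B, [disjoint A & B],
      rk M A + rk M B = rank M & rk M (A :|: B) = rank M].

Section SeriesDecomposition.
Variables (T : finType) (M : matroid T) (e : T).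
Implicit Types (A B C XA XB : {set T}).
Local Notation E := (ground M).

Lemma separates_sym A B : separates M e A B -> separates M e B A.
Proof. by case=> eE eAB dAB rAB rU; split=> //; rewrite 1?(setUC B) 1?disjoint_sym 1?addnC. Qed.

(** Additivity passes from [A] and [B] to subsets: add the submodular inequalities for the pairs
    [XA :|: B], [A] and [XA :|: XB], [B]. *)
Lemma separates_rkU A B XA XB : separates M e A B ->
  XA \subset A -> XB \subset B -> rk M (XA :|: XB) = rk M XA + rk M XB.
Proof.
case=> _ _ dAB rAB rU sA sB.
apply/eqP; rewrite eqn_leq rkU /=.
have dBA := disjoint_setI0 dAB.
have h1 := rkUI M (XA :|: B) A; have h2 := rkUI M (XA :|: XB) B.
have e1 : (XA :|: B) :|: A = A :|: B by rewrite setUAC (setUidPr sA).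
have e2 : (XA :|: B) :&: A = XA by rewrite setIUl (setIidPl sA) setIC dBA setU0.
have e3 : (XA :|: XB) :|: B = XA :|: B by rewrite -setUA (setUidPr sB).
have e4 : (XA :|: XB) :&: B = XB.
  by rewrite setIUl (setIidPl sB) (disjoint_setI0 (disjointWl sA dAB)) set0U.
rewrite e1 e2 e3 e4 in h1 h2; lia.
Qed.

(** Otherwise an element of [C :&: A] would lie in the closure of the hyperplane [E :\: C]. *)
Lemma cocircuit_not_spanning C A : A \subset E -> cocircuit M C -> C :&: A != set0 ->
  rk M (A :\: C) < rk M A.
Proof.
move=> sA /cocircuitP[sC ltC minC] /set0Pn[y /setIP[yC yA]].
rewrite ltn_neqAle rkS ?subsetDl // andbT; apply/negP => /eqP eA.
have := minC y yC; rewrite leqNgt setUC (@rkU_closure _ _ (A :\: C)) ?ltC ?setSD //.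
apply/eqP; rewrite eqn_leq (rkS _ (subsetUl _ _)) andbT eA rkS //.
by rewrite subUset subsetDl sub1set.
Qed.

(** A cocircuit meeting both parts lowers the rank of each, so what it leaves of [A :|: B] has rank
    at most [rank M - 2]. The hyperplane [E :\: C] therefore needs [e], and each part drops by
    exactly one. *)
Lemma separates_cocircuit A B C : separates M e A B -> cocircuit M C ->
  C :&: A != set0 -> C :&: B != set0 -> e \notin C /\ cocircuit M (e |: C :&: A).
Proof.
move=> hS hC CA CB; have [eE eAB dAB rAB rU] := hS.
have sA : A \subset E by rewrite eE setUCA subsetUl.
have sB : B \subset E by rewrite eE setUA subsetUr.
have hA := cocircuit_not_spanning sA hC CA; have hB := cocircuit_not_spanning sB hC CB.
have [sC ltC minC] := cocircuitP _ _ hC.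
have rX := separates_rkU hS (subsetDl A C) (subsetDl B C).
have eX : E :\: C \subset e |: (A :\: C :|: B :\: C).
  by rewrite eE; apply/subsetP => x; rewrite !inE; case: (x \in C) => //=; rewrite !orbF.
have eC : e \notin C.
  apply/negP => eC; case/set0Pn: CA => y /setIP[yC _].
  have s : E :\: C \subset A :\: C :|: B :\: C.
    apply/subsetP => x xX; have := subsetP eX x xX; move: xX; rewrite !inE.
    by case: eqP => // ->; rewrite eC.
  have := minC y yC; have := rkU1 M y (E :\: C); have := rkS M s; lia.
split=> //.
have addA y : y \in C -> y \in A -> rk M A <= rk M (y |: (A :\: C)) /\ rk M B = (rk M (B :\: C)).+1.
  move=> yC yA; have h1 := minC y yC.
  have h2 : rk M (y |: (E :\: C)) <= (rk M (y |: (A :\: C) :|: B :\: C)).+1.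
    apply: leq_trans (rkU1 M e _); apply: rkS.
    by rewrite -setUA setUCA setUS.
  rewrite (separates_rkU hS (XA := y |: _)) ?subsetDl // ?subUset ?sub1set ?yA ?subsetDl // in h2.
  have := rkS M (_ : y |: (A :\: C) \subset A); rewrite subUset sub1set yA subsetDl.
  move=> /(_ isT); lia.
have addB y : y \in C -> y \in B -> rk M A = (rk M (A :\: C)).+1.
  move=> yC yB; have h1 := minC y yC.
  have h2 : rk M (y |: (E :\: C)) <= (rk M (A :\: C :|: (y |: (B :\: C)))).+1.
    apply: leq_trans (rkU1 M e _); apply: rkS.
    by rewrite (setUCA (A :\: C)) setUCA setUS.
  rewrite (separates_rkU hS (XB := y |: _)) ?subsetDl // ?subUset ?sub1set ?yB ?subsetDl // in h2.
  have := rkS M (_ : y |: (B :\: C) \subset B); rewrite subUset sub1set yB subsetDl.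
  move=> /(_ isT); lia.
have eD : E :\: (e |: C :&: A) = A :\: C :|: B.
  rewrite eE; apply/setP => x; rewrite !inE; have [->|_] := eqVneq x e.
    by move: eAB; rewrite inE negb_or => /andP[/negPf-> /negPf->] /=; rewrite andbF.
  case: (boolP (x \in A)) => [xA|_] /=; last by rewrite !andbF.
  by rewrite (disjointFr dAB xA) !andbT orbF.
have [yB /setIP[yBC yBB]] := set0Pn _ CB.
apply/cocircuitP; rewrite eD; split.
- by rewrite subUset sub1set eE setU11 -eE (subset_trans (subsetIl _ _)).
- by rewrite (separates_rkU hS) ?subsetDl // -rAB (addB yB) // addSn.
move=> x; rewrite !inE => /predU1P[->|/andP[xC xA]].
  (* Returning [e] gives a set containing [yB |: (E :\: C)], which spans. *)
  apply: leq_trans (minC yB yBC) (rkS _ _); rewrite subUset sub1set !inE yBB !orbT /=.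
  by apply: subset_trans eX _; rewrite setUS // setUS // subsetDl.
rewrite setUA (separates_rkU hS) // -?rAB ?leq_add2r; try by case: (addA x).
by rewrite subUset sub1set xA subsetDl.
Qed.

(** The complement of the join is [e |: (A :\: C2 :|: B :\: C1)]. Each part falls short of its full
    rank and [e] recovers at most one, so it does not span. *)
Lemma separates_join A B C1 C2 : separates M e A B ->
  cocircuit M C1 -> C1 \subset E :\: A -> e \in C1 ->
  cocircuit M C2 -> C2 \subset E :\: B -> e \in C2 ->
  cocircuit M ((C1 :|: C2) :\ e).
Proof.
have compl A' B' C : separates M e A' B' -> C \subset E :\: A' -> e \in C ->
    E :\: C = A' :|: (B' :\: C).
  move=> [eE eAB _ _ _] sC eC; apply/setP => x; rewrite eE !inE.
  have [->|_] := eqVneq x e; first by move: eAB; rewrite eC inE => /norP[/negPf-> _].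
  have [xC|//] := boolP (x \in C); rewrite orbF.
  by have := subsetP sC x xC; rewrite inE => /andP[/negPf->].
have span A' B' C C' y : separates M e A' B' -> cocircuit M C' ->
    C' \subset E :\: A' -> e \in C' -> cocircuit M C -> C \subset E :\: B' ->
    e \in C -> y \in C -> y != e ->
    rank M <= rk M (y |: (e |: (A' :\: C :|: B' :\: C'))).
  move=> hS hC' sC' eC' hC sC eC yC ye; have [eE _ _ rAB _] := hS.
  have [_ _ /(_ y yC)] := cocircuitP _ _ hC.
  have yA : y \in A'.
    have := subsetP sC y yC; rewrite eE !inE (negPf ye) /=.
    by case: (y \in A') => //=; case: (y \in B').
  have sA : y |: (A' :\: C) \subset A' by rewrite subUset sub1set yA subsetDl.
  rewrite (compl _ _ _ (separates_sym hS) sC eC) (setUC B') setUA.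
  rewrite (separates_rkU hS) // -{1}rAB leq_add2r => hA.
  (* Once [y] is returned, the remainder of [A'] spans [A']; adjoining [A'] is then free, and [e]
     completes the hyperplane [E :\: C'] because [e] is in [C']. *)
  have cl : rk M (y |: (A' :\: C) :|: A') = rk M (y |: (A' :\: C)).
    by rewrite (setUidPr sA); apply/eqP; rewrite eqn_leq hA rkS.
  have -> : y |: (e |: (A' :\: C :|: B' :\: C')) =
      (y |: (A' :\: C)) :|: (e |: (B' :\: C')).
    by rewrite -[RHS]setUA; congr (_ :|: _); apply: setUCA.
  rewrite -(rkU_closure (subsetUl _ _) cl).
  have [_ _ /(_ e eC') hr] := cocircuitP _ _ hC'; apply: leq_trans hr (rkS _ _).
  rewrite (compl _ _ _ hS sC' eC'); apply/subsetP => x; rewrite !inE.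
  by case/or3P => ->; rewrite ?orbT.
move=> hS h1 s1 e1 h2 s2 e2; have [eE eAB dAB rAB _] := hS.
have eX : E :\: ((C1 :|: C2) :\ e) = e |: (A :\: C2 :|: B :\: C1).
  rewrite eE; apply/setP => x; rewrite !inE; have [//|/= xe] := eqVneq x e.
  have := subsetP s1 x; have := subsetP s2 x; rewrite eE !inE (negPf xe) /=.
  have [xA|] := boolP (x \in A); last first.
    by case: (x \in B) (x \in C1) (x \in C2) => [] [] [] // _ /(_ isT).
  by rewrite (disjointFr dAB xA); case: (x \in C1) (x \in C2) => [] [] // _ /(_ isT).
apply/cocircuitP; rewrite eX; split.
- apply: subset_trans (subsetDl _ _) _; rewrite subUset.
  by case/cocircuitP: h1 => -> _ _; case/cocircuitP: h2.
- apply: leq_ltn_trans (rkU1 _ _ _) _.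
  rewrite (separates_rkU hS) ?subsetDl //.
  have [_ + _] := cocircuitP _ _ h1; have [_ + _] := cocircuitP _ _ h2.
  rewrite (compl _ _ _ hS s1 e1) (compl _ _ _ (separates_sym hS) s2 e2) (setUC B).
  by rewrite !(separates_rkU hS) ?subsetDl //; lia.
move=> y; rewrite in_setD1 => /andP[ye /setUP[yC|yC]].
  by rewrite (setUC (A :\: _)); apply: (span _ _ _ _ _ (separates_sym hS) h2).
exact: (span _ _ _ _ _ hS h1).
Qed.

(** Cocircuits of [M] missing one part are those of the corresponding contraction; those meeting
    both parts split at [e] and rejoin. The strict rank inequalities say that [e] is not a loop of
    either contraction, and it is no coloop because [A :|: B] spans. *)
Lemma series_connection_contraction A B (M1 M2 : matroid T) :
  separates M e A B -> rk M A < rk M (e |: A) -> rk M B < rk M (e |: B) ->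
  is_contraction M A M1 -> is_contraction M B M2 -> series_connection e M1 M2 M.
Proof.
have part A' B' (N : matroid T) : separates M e A' B' ->
    is_contraction M A' N -> ground N = e |: B'.
  move=> [eE eAB dAB _ _] [-> _]; rewrite eE; apply/setP => x; rewrite !inE.
  have [->|_] := eqVneq x e; first by move: eAB; rewrite inE => /norP[/negPf->].
  by have [xA|//] := boolP (x \in A'); rewrite (disjointFr dAB xA).
have basepoint A' B' (N : matroid T) : separates M e A' B' ->
    rk M A' < rk M (e |: A') -> is_contraction M A' N -> ~~ is_loop N e && ~~ is_coloop N e.
  move=> hS clA hN; have eN := part _ _ _ hS hN; have [eE eAB dAB rAB rU] := hS.
  have sA : A' \subset E by rewrite eE setUCA subsetUl.
  rewrite /is_coloop /is_loop [ground (dual N)]/= eN setU11 /= !negbK.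
  rewrite indep1_rk (_ : [set e] \in coindep N = ([set e] \in indep (dual N))) //.
  rewrite coindep_rk eN sub1set setU11 setU1K /=; last first.
    by move: eAB; rewrite inE => /norP[].
  apply/andP; split.
    by rewrite -(ltn_add2r (rk M A')) hN.2 // eN sub1set setU11.
  by rewrite -(leq_add2r (rk M A')) hN.2 ?eN ?subsetUr // (contraction_rank sA hN) setUC rU.
move=> hS clA clB h1 h2; have [eE eAB dAB rAB rU] := hS.
have hS' := separates_sym hS.
have sA : A \subset E by rewrite eE setUCA subsetUl.
have sB : B \subset E by rewrite eE setUA subsetUr.
have g1 := part _ _ _ hS h1; have g2 := part _ _ _ hS' h2.
split.
- by rewrite g1 g2 -setUIr setIC (disjoint_setI0 dAB) setU0.
- have /andP[-> ->] := basepoint _ _ _ hS clA h1.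
  by have /andP[-> ->] := basepoint _ _ _ hS' clB h2.
- by rewrite g1 g2 eE setUACA setUid (setUC B).
have c1 := contraction_cocircuit sA h1; have c2 := contraction_cocircuit sB h2.
move=> C; split.
  move=> hC; have sC : C \subset E by case/cocircuitP: hC.
  have [CA|CA] := eqVneq (C :&: A) set0.
    by apply: Or31; apply/c1; rewrite subsetD sC -setI_eq0 CA eqxx.
  have [CB|CB] := eqVneq (C :&: B) set0.
    by apply: Or32; apply/c2; rewrite subsetD sC -setI_eq0 CB eqxx.
  have [eC hCA] := separates_cocircuit hS hC CA CB.
  have [_ hCB] := separates_cocircuit hS' hC CB CA.
  apply: Or33; exists (e |: C :&: B), (e |: C :&: A); rewrite !setU11.
  have eNA : (e |: C :&: B) \subset E :\: A by rewrite h1.1 in g1; rewrite g1 setUS ?subsetIr.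
  have eNB : (e |: C :&: A) \subset E :\: B by rewrite h2.1 in g2; rewrite g2 setUS ?subsetIr.
  split; first by split=> //; apply/c1.
    by split=> //; apply/c2.
  apply/setP => x; have := subsetP sC x; rewrite eE !inE.
  have [->|_ /=] := eqVneq x e; first by rewrite (negPf eC).
  by case: (x \in C) => //= /(_ isT); rewrite orbC.
case=> [/c1[]|/c2[]|[C1 [C2 [[/c1[hC1 s1] e1] [/c2[hC2 s2] e2] ->]]]] //.
exact: (separates_join hS).
Qed.

End SeriesDecomposition.

(** * Minimal degeneracy in terms of rank, and the rank 1 case *)

Lemma cogirth_leq (T : finType) (M : matroid T) (X : {set T}) :
  X \subset ground M -> rk M X < rank M -> cogirth M <= #|ground M :\: X|.
Proof.
move=> sX ltX; have [C hC sC] := exists_cocircuit sX ltX.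
apply: leq_trans (subset_leq_card sC); rewrite /cogirth.
have : C \in index_enum {set T} by rewrite mem_index_enum.
elim: (index_enum _) => // D s IH; rewrite inE big_cons => /predU1P[<-|/IH le].
  by rewrite hC geq_minl.
by case: ifP => // _; apply: leq_trans (geq_minr _ _) le.
Qed.

Lemma cogirth_attained (T : finType) (M : matroid T) : 0 < rank M ->
  exists X : {set T}, [/\ X \subset ground M, rk M X < rank M
                     & #|ground M :\: X| = cogirth M].
Proof.
(* The empty set gives cogirth at most [#|ground M|], which excludes the default value of the
   minimum. *)
move=> r0; have hs := @cogirth_leq _ M set0 (sub0set _); rewrite rk0 setD0 in hs.
have : cogirth M = #|ground M|.+1 \/ exists2 C, cocircuit M C & #|C| = cogirth M.
  rewrite /cogirth; elim/big_rec: _ => [|C n hC IH]; first by left.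
  by rewrite /minn; case: ifP => // _; right; exists C.
case=> [eC|[C hC eC]]; first by have := hs r0; rewrite eC ltnn.
have [sC ltC _] := cocircuitP _ _ hC; exists (ground M :\: C).
by rewrite subsetDl setDDr setDv set0U (setIidPr sC).
Qed.

(* [minimally_degenerate] in terms of the rank function. That some cocircuit has
   at most [k] elements is implied, by applying the last condition to the
   deletion of an element. *)
Definition rank_degenerate (T : finType) (k : nat) (M : matroid T) : Prop :=
  [/\ {in ground M, forall x, 0 < rk M [set x]},
      ground M != set0,
      forall X : {set T}, X \subset ground M -> rk M X < rank M ->
        k <= #|ground M :\: X|
    & forall X : {set T}, X != set0 -> X \proper ground M ->
        exists Y : {set T}, [/\ Y \subset X, rk M Y < rk M X & #|X :\: Y| < k]].

Lemma minimally_degenerate_rank (T : finType) (k : nat) (M : matroid T) :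
  0 < k -> minimally_degenerate k M -> rank_degenerate k M.
Proof.
move=> k0 [lM E0 ek hX]; subst k; have l1 : {in ground M, forall x, 0 < rk M [set x]}.
  move=> x xE; rewrite -indep1_rk; have /forallP/(_ x) := lM.
  by rewrite /is_loop xE negbK.
split=> // X; first exact: cogirth_leq.
move=> X0 pX; have := hX X X0 pX; have sX := proper_sub pX.
have [] := @cogirth_attained _ (restrict M X).
  case/set0Pn: X0 => x xX; rewrite rank_rk rk_restrict /=.
  apply: leq_trans (l1 x (subsetP sX x xX)) (rkS _ _).
  by rewrite sub1set !inE xX (subsetP sX).
move=> Y [/=]; rewrite rank_rk !rk_restrict /= (setIidPr sX) setIid => sY ltY <- leY.
exists Y; rewrite (setIidPr sY) in ltY; split=> //.
lia.
Qed.

(** Without loops and in rank 1, the independent sets are the sets of at most one element, so any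
    enumeration of the ground set is an isomorphism. *)
Lemma rank1_iterated_series (T : finType) (k : nat) (M : matroid T) :
  {in ground M, forall x, 0 < rk M [set x]} -> rank M = 1 -> #|ground M| = k ->
  iterated_series k M.
Proof.
move=> l1 r1 cE; apply: iterated_series_iso (iterated_series_uniform k) _.
pose f (i : 'I_k) := enum_val (cast_ord (esym cE) i).
have fI : injective f by move=> i j /enum_val_inj/cast_ord_inj.
exists f; split=> [i j _ _|/=|I _]; first exact: fI.
  apply/setP => x; apply/imsetP/idP => [[i _ ->]|xE]; first exact: enum_valP.
  exists (cast_ord cE (enum_rank_in xE x)); rewrite ?inE //.
  by rewrite /f cast_ordK enum_rankK_in.
rewrite inE; apply/idP/idP => [|hI].
  rewrite leq_eqVlt ltnS leqn0 cards_eq0 => /orP[/cards1P[i ->]|/eqP->].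
    by rewrite imset_set1 indep1_rk l1 // enum_valP.
  by rewrite imset0 indep0.
rewrite -(card_imset _ fI) -r1 rank_rk leq_card_rk //; exact: indep_ground.
Qed.

(** * The upper bound, tight sets, and the separation in the equality case *)

Section Degenerate.
Variables (T : finType) (k : nat) (M : matroid T).
Hypotheses (k2 : 1 < k) (hM : rank_degenerate k M).
Implicit Types (X Y P H : {set T}).
Local Notation E := (ground M).

(** Passing from [X] to [Y] costs at most [k - 1] elements and at least one unit of rank. *)
Lemma degenerate_proper_card X : X \proper E -> #|X| <= (k - 1) * rk M X.
Proof.
have [_ _ _ hX] := hM.
have [n] := ubnP #|X|; elim: n X => // n IH X leX pX.
have [->|X0] := eqVneq X set0; first by rewrite cards0.
have [Y [sY ltY cY]] := hX X X0 pX.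
have pY : Y \proper E by apply: sub_proper_trans pX.
have cX := cardsID Y X; rewrite (setIidPr sY) in cX.
have ltc : #|Y| < #|X|.
  apply: proper_card; rewrite properE sY; apply/negP => sXY.
  by have := rkS M sXY; lia.
have := IH Y (leq_trans ltc leX) pY; nia.
Qed.

Lemma degenerate_spanning X : X \subset E -> #|E :\: X| < k -> rk M X = rank M.
Proof.
have [_ _ hyp _] := hM; move=> sX; apply: contraTeq => neX.
by rewrite -leqNgt hyp // ltn_neqAle neX rank_rk rkS.
Qed.

Lemma degenerate_delete y : y \in E ->
  exists Y, [/\ Y \subset E :\ y, rk M Y < rank M & #|E| <= #|Y| + k].
Proof.
move=> yE; have [_ _ hyp hX] := hM.
(* The empty set is not spanning; with [1 < k] this makes [E :\ y] non-empty, so that it has a small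
   cocircuit. *)
have cE : k <= #|E|.
  rewrite -[E]setD0 hyp ?sub0set // rk0 rank_rk.
  have [l1 _ _ _] := hM.
  by apply: leq_trans (l1 y yE) (rkS _ _); rewrite sub1set.
have cy := cardsD1 y E; rewrite yE in cy.
have [||Y [sY ltY cY]] := hX (E :\ y).
- by rewrite -card_gt0; lia.
- exact: properD1.
exists Y; split=> //.
  by apply: leq_trans ltY _; rewrite rank_rk rkS ?subsetDl.
have := cardsID Y (E :\ y); rewrite (setIidPr sY); lia.
Qed.

Lemma degenerate_card : #|E| <= (k - 1) * rank M + 1.
Proof.
have [_ /set0Pn[y yE] _ _] := hM; have [Y [sY ltY cY]] := degenerate_delete yE.
(* Here |E| <= |Y| + k <= (k-1)(r(M)-1) + k = (k-1) r(M) + 1. *)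
have := degenerate_proper_card (sub_proper_trans sY (properD1 yE)); nia.
Qed.

Definition tight X : Prop := #|X| = (k - 1) * rk M X.

(** For tight [X], the bound on [Y] forces the rank to drop by exactly one and [Y] to be tight
    again, until rank 1 is reached. *)
Lemma tight_point X : X != set0 -> X \proper E -> tight X ->
  exists P, [/\ P \subset X, rk M P = 1 & #|P| = k - 1].
Proof.
rewrite /tight; have [_ _ _ hX] := hM.
have [n] := ubnP (rk M X); elim: n X => // n IH X leX X0 pX tX.
have [Y [sY ltY cY]] := hX X X0 pX.
have pY : Y \proper E by apply: sub_proper_trans pX.
have cX := cardsID Y X; rewrite (setIidPr sY) in cX.
have leY := degenerate_proper_card pY.
have [rX|rX] := eqVneq (rk M X) 1; first by exists X; rewrite tX rX muln1.
have eY : rk M X = (rk M Y).+1 by nia.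
have [|||P [sP rP cP]] := IH Y _ _ pY; last by exists P; rewrite (subset_trans sP sY).
- by lia.
- by rewrite -card_gt0; nia.
by nia.
Qed.

Hypotheses (tE : #|E| = (k - 1) * rank M + 1) (r2 : 1 < rank M).

(** Equality for [E] forces equality at each step of the estimate in [degenerate_card]. *)
Lemma tight_hyperplane y : y \in E ->
  exists H, [/\ H \subset E :\ y, (rk M H).+1 = rank M & tight H].
Proof.
move=> yE; have [Y [sY ltY cY]] := degenerate_delete yE; exists Y.
have := degenerate_proper_card (sub_proper_trans sY (properD1 yE)).
rewrite /tight => leY; have eY : (rk M Y).+1 = rank M by nia.
by split=> //; nia.
Qed.

Lemma degenerate_separates : exists e H P,
  [/\ separates M e H P, (rk M H).+1 = rank M, rk M P = 1 & #|P| = k - 1].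
Proof.
have [_ /set0Pn[y yE] _ _] := hM.
have [H0 [sH0 rH0 tH0]] := tight_hyperplane yE.
have [||P [sP rP cP]] := tight_point _ _ tH0.
- by rewrite -card_gt0 tH0; nia.
- exact: sub_proper_trans sH0 (properD1 yE).
have sPE : P \subset E.
  by apply: subset_trans sP (subset_trans sH0 (subsetDl _ _)).
have [p pP] : exists p, p \in P by apply/card_gt0P; lia.
have pE := subsetP sPE p pP.
have [H [sH rH tH]] := tight_hyperplane pE.
move: sH; rewrite subsetD1 => /andP[sH pH].
have cH := cardsID H E; rewrite (setIidPr sH) in cH.
have cEH : #|E :\: H| = k by rewrite /tight in tH; nia.
(* An element [q] of [H :&: P] would be parallel to [p], so [p |: H] would have the rank of [H]; but
   it misses only [k - 1] elements and must span. *)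
have dHP : [disjoint H & P].
  rewrite -setI_eq0; apply: contraT => /set0Pn[q /setIP[qH qP]].
  have lq : rk M [set q] = 1.
    apply/eqP; rewrite eqn_leq -{1}rP rkS ?sub1set //=.
    by have [l1 _ _ _] := hM; apply: l1; rewrite (subsetP sPE).
  have rp : rk M (H :|: [set p]) = rk M H.
    apply: (@rkU_closure _ M [set q]); first by rewrite sub1set.
    apply/eqP; rewrite eqn_leq (rkS _ (subsetUl _ _)) andbT lq -rP rkS //.
    by rewrite subUset !sub1set qP.
  have := @degenerate_spanning (H :|: [set p]).
  rewrite subUset sH sub1set pE rp => /(_ isT).
  rewrite -setDDl; have := cardsD1 p (E :\: H); rewrite inE pH pE /=; lia.
have sPH : P \subset E :\: H by rewrite subsetD sPE disjoint_sym.
(* Of the [k] elements outside [H], the set [P] takes [k - 1]; the remaining one is the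
   basepoint. *)
have /cards1P[e ee] : #|E :\: H :\: P| == 1.
  have := cardsID P (E :\: H); rewrite (setIidPr sPH) cEH cP; lia.
have eE : E = e |: (H :|: P).
  have sHP : H :|: P \subset E by rewrite subUset sH.
  by rewrite -ee setDDl setUC -{1}(setID E (H :|: P)) (setIidPr sHP).
exists e, H, P; split=> //; split=> //.
- by have := set11 e; rewrite -ee !inE negb_or => /and3P[-> -> _].
- by rewrite rP addn1.
by apply: degenerate_spanning; rewrite ?subUset ?sH // -setDDl ee cards1.
Qed.

End Degenerate.

(** * Splitting off one copy of the rank 1 uniform matroid *)

Section EqualityStep.
Variables (T : finType) (k : nat) (M : matroid T) (e : T) (H P : {set T}).
Hypotheses (k2 : 1 < k) (hM : rank_degenerate k M).
Local Notation E := (ground M).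
Hypotheses (tE : #|E| = (k - 1) * rank M + 1) (r2 : 1 < rank M).
Hypotheses (hS : separates M e H P) (rH : (rk M H).+1 = rank M) (rP : rk M P = 1)
  (cP : #|P| = k - 1).

Let eE : E = e |: (H :|: P). Proof. by case: hS. Qed.
Let sH : H \subset E. Proof. by rewrite eE setUCA subsetUl. Qed.
Let sP : P \subset E. Proof. by rewrite eE setUA subsetUr. Qed.
Let dHP : [disjoint H & P]. Proof. by case: hS. Qed.

Lemma point_closed x : x \in E :\: P -> 1 < rk M (x |: P).
Proof.
rewrite inE => /andP[xP xE]; have cx : #|x |: P| = k by rewrite cardsU1 xP; lia.
have := @degenerate_proper_card _ _ _ k2 hM (x |: P).
(* With rank at least 2, [E] has at least 2k-1 > k elements, so [x |: P] is proper; its [k] elements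
   exceed the bound for rank 1. *)
rewrite properEcard subUset sub1set xE sP cx tE /=; nia.
Qed.

Lemma card_hyperplane_compl : #|E :\: H| = k.
Proof.
have -> : E :\: H = e |: P.
  have [_ eHP _ _ _] := hS; rewrite eE; apply/setP => x; rewrite !inE.
  have [->|_] := eqVneq x e; first by move: eHP; rewrite inE => /norP[->].
  by have [xH|//] := boolP (x \in H); rewrite (disjointFr dHP xH).
have [_ + _ _ _] := hS; rewrite inE => /norP[_ eP].
by rewrite cardsU1 eP cP; lia.
Qed.

(** Only [k - 1] elements remain outside [x |: H], fewer than any cocircuit has. *)
Lemma hyperplane_closed x : x \in E :\: H -> rk M (x |: H) = rank M.
Proof.
move=> xEH; have /andP[xH xE] : (x \notin H) && (x \in E) by rewrite -in_setD.
apply: (degenerate_spanning hM); first by rewrite subUset sub1set xE.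
rewrite setUC -setDDl; have := cardsD1 x (E :\: H).
by rewrite xEH card_hyperplane_compl; lia.
Qed.

Lemma contract_hyperplane N : is_contraction M H N -> iterated_series k N.
Proof.
move=> hN; have [eN rN] := hN; apply: rank1_iterated_series.
- move=> x xN; rewrite -(ltn_add2r (rk M H)) rN ?sub1set //.
  by rewrite hyperplane_closed -?eN // -rH.
- by have := contraction_rank sH hN; lia.
by rewrite eN card_hyperplane_compl.
Qed.

(** Looplessness holds because [P] is closed, and [X] in [N] has the same complement as [X :|: P] in
    [M]. For a proper [X], the small cocircuit comes from that of [X :|: P] in [M], according to
    whether [Y] meets [P]. *)
Lemma contract_point_degenerate N : is_contraction M P N -> rank_degenerate k N.
Proof.
move=> hN; have [eN rN] := hN; have rkN := contraction_rank sP hN; rewrite rP in rkN rN.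
have [_ _ hyp hX] := hM.
have sNE (X : {set T}) : X \subset ground N -> X :|: P \subset E.
  by rewrite eN subsetD => /andP[sX _]; rewrite subUset sX.
split.
- by move=> x xN; rewrite -(ltn_add2r 1) rN ?sub1set // point_closed // -eN.
- rewrite eN -card_gt0 cardsD (setIidPr sP) cP tE subn_gt0; nia.
- move=> X sX; rewrite -(ltn_add2r 1) rN // rkN => /(hyp _ (sNE X sX)).
  by rewrite eN setDDl setUC.
move=> X X0 pX; have sX := proper_sub pX.
have pXE : X \proper E by apply: proper_sub_trans pX _; rewrite eN subsetDl.
have dXP : [disjoint X & P] by move: sX; rewrite eN subsetD => /andP[].
have pXP : X :|: P \proper E.
  case/properP: pX => _ [y yN yX]; apply/properP; split; first exact: sNE.
  by exists y; move: yN; rewrite eN inE => /andP[yP yE] //; rewrite inE negb_or yX.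
have [|Y [sY ltY cY]] := hX (X :|: P) _ pXP.
  by apply: contraNneq X0 => eXP; rewrite -subset0 -eXP subsetUl.
have [YP|[q qYP]] := set_0Vmem (Y :&: P); last first.
  move: qYP => /setIP[qY qP].
  have sYX : Y :\: P \subset X by rewrite subDset setUC.
  exists (Y :\: P); split=> //.
    rewrite -(ltn_add2r 1) !rN ?(subset_trans sYX) //.
    have -> : Y :\: P :|: P = Y :|: P.
      by apply/setP => x; rewrite !inE; case: (x \in P); rewrite ?orbT ?orbF.
    have [l1 _ _ _] := hM.
    (* The element [q] of [Y] spans the rank 1 set [P], so adjoining [P] to [Y] leaves the rank
       unchanged. *)
    rewrite (@rkU_closure _ _ [set q]) ?sub1set //.
    apply/eqP; rewrite eqn_leq (rkS _ (subsetUl _ _)) andbT (setUidPr _) ?sub1set // rP.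
    by apply: l1; apply: (subsetP sP).
  apply: leq_ltn_trans (subset_leq_card _) cY; apply/subsetP => x.
  rewrite !inE negb_and negbK => /andP[/orP[xP|->] xX]; last by rewrite xX.
  by rewrite (disjointFr dXP xX) in xP.
have sYX : Y \subset X.
  apply/subsetP => y yY; have /setUP[//|yP] := subsetP sY y yY.
  by have := in_set0 y; rewrite -YP inE yY yP.
(* If [Y] misses [P], the at most [k - 1] removed elements are already those of [P]. Hence [P] adds
   to the rank of [X], and a small cocircuit of the restriction of [M] to [X] serves for [N]. *)
have eY : Y = X.
  apply/eqP; rewrite eqEcard sYX /=.
  have := cardsID Y (X :|: P); rewrite (setIidPr sY).
  have := cardsUI X P; rewrite (disjoint_setI0 dXP) cards0; lia.
rewrite {}eY in ltY.
have [Z [sZ ltZ cZ]] := hX X X0 pXE; exists Z; split=> //.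
rewrite -(ltn_add2r 1) !rN ?(subset_trans sZ) //.
by have := rkU M Z P; rewrite rP; lia.
Qed.

Lemma equality_step :
  exists N : matroid T, [/\ rank_degenerate k N, (rank N).+1 = rank M,
    #|ground N| = (k - 1) * rank N + 1
    & iterated_series k N -> iterated_series k M].
Proof.
have [M1 h1] := exists_contraction M H; have [M2 h2] := exists_contraction M P.
have rk2 := contraction_rank sP h2; rewrite rP addn1 in rk2.
exists M2; split=> //; first exact: contract_point_degenerate.
  by rewrite h2.1 cardsD (setIidPr sP) cP tE; nia.
move=> it2; apply: iterated_series_connection (contract_hyperplane h1) it2 _.
have [_ + _ _ _] := hS; rewrite inE => /norP[eH eP].
have eEE : e \in E by rewrite eE setU11.
(* The element [e] is outside the closures of [H] and [P], hence a loop of neither contraction. *)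
apply: (series_connection_contraction hS) h1 h2; first by rewrite hyperplane_closed ?inE ?eH // -rH.
by rewrite rP point_closed // inE eP.
Qed.

End EqualityStep.

(** * Induction on the rank, and the conclusion *)

Lemma degenerate_iterated_series (T : finType) (k : nat) (M : matroid T) :
  1 < k -> rank_degenerate k M -> #|ground M| = (k - 1) * rank M + 1 ->
  iterated_series k M.
Proof.
move=> k2; have [n] := ubnP (rank M); elim: n M => // n IH M ltn hM tE.
have [l1 /set0Pn[x xE] _ _] := hM.
have r0 : 0 < rank M.
  by apply: leq_trans (l1 x xE) _; rewrite rank_rk rkS ?sub1set.
have [r1|r1] := eqVneq (rank M) 1.
  by apply: rank1_iterated_series => //; rewrite tE r1; lia.
have r2 : 1 < rank M by lia.
have [e [H [P [hS rH rP cP]]]] := degenerate_separates k2 hM tE r2.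
have [N [hN rN tN]] := equality_step k2 hM tE r2 hS rH rP cP.
by apply; apply: IH => //; lia.
Qed.

Theorem theorem1p3 (T : finType) (k : nat) (M : matroid T)
    (hk : 2 <= k) (hM : minimally_degenerate k M) :
  #|ground M| <= (k - 1) * rank M + 1 /\
  (#|ground M| = (k - 1) * rank M + 1 <-> iterated_series k M).
Proof.
have k0 : 0 < k := ltnW hk.
have hR := minimally_degenerate_rank k0 hM.
split; first exact: degenerate_card hR.
by split; [apply: degenerate_iterated_series | apply: iterated_series_card].
Qed.
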